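(* Let $\Phi\in\mathcal{E}(I)$ and $f:I\to\mathbb{R}$. Then the following conditions are equivalent to each other: (i) $f$ is $\Phi$-convex; (ii) for all $x,u,y\in I$ with $x<u<y$, $$\frac{f(u)-f(x)-\Phi(u-x)}{u-x}\leq \frac{f(y)-f(u)+\Phi(y-u)}{y-u};$$ (iii) there exists a function $\varphi:I\to\mathbb{R}$ such that, for all $x,u\in I$, $$f(u)+(x-u)\varphi(u)\leq f(x)+\Phi(|u-x|);$$ (iv) for all $n\in\mathbb{N}$, $x_1,\dots,x_n\in I$, and $t_1,\dots,t_n\geq0$ with $t_1+\dots+t_n=1$, $$f(t_1x_1+\dots+t_nx_n)\leq \sum_{i=1}^{n}t_i\big(f(x_i)+\Phi(|(t_1x_1+\dots+t_nx_n)-x_i|)\big).$$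
   Context: $I\subseteq\mathbb{R}$ is a nonempty open interval and $\ell(I)\in(0,\infty]$ is its length. $\mathcal{E}(I)$ is the set of all functions $\Phi:[0,\ell(I))\to[0,\infty)$ (called error functions). For $\Phi\in\mathcal{E}(I)$, a function $f:I\to\mathbb{R}$ is called $\Phi$-convex if for all $x,y\in I$ and $t\in[0,1]$, $$f(tx+(1-t)y)\leq tf(x)+(1-t)f(y)+t\Phi((1-t)|x-y|)+(1-t)\Phi(t|x-y|).$$ *)

(* Defs.v *)
From HB Require Import structures.
From mathcomp Require Import all_boot all_order all_algebra.
From mathcomp Require Import all_classical all_reals all_analysis.
Set Implicit Arguments.
Unset Strict Implicit.
Unset Printing Implicit Defensive.
Import Order.TTheory GRing.Theory Num.Theory.
Import numFieldNormedType.Exports.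
Local Open Scope classical_set_scope.
Local Open Scope ring_scope.

(* Functions on I or on [0, l(I)) are represented by total functions R -> R of
   which only the values on that domain are used or constrained. *)

(* [0, l(I)), where l(I), possibly infinite, is the length of the interval I. *)
Definition error_domain (R : realType) (I : set R) : set R :=
  [set r | 0 <= r /\ (r%:E < wlength idfun I)%E].

Definition error_function (R : realType) (I : set R) (Phi : R -> R) : Prop :=
  set_fun (error_domain I) [set s | 0 <= s] Phi.

Definition Phi_convex (R : realType) (I : set R) (Phi f : R -> R) : Prop :=
  forall x y t : R, I x -> I y -> 0 <= t <= 1 ->
    f (t * x + (1 - t) * y) <=
      t * f x + (1 - t) * f y
      + t * Phi ((1 - t) * `|x - y|) + (1 - t) * Phi (t * `|x - y|).

(* Main.v *)
Require Import Defs.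
From HB Require Import structures.
From mathcomp Require Import all_boot all_order all_algebra.
From mathcomp Require Import all_classical all_reals all_analysis.
From mathcomp Require Import ring lra.
Set Implicit Arguments.
Unset Strict Implicit.
Unset Printing Implicit Defensive.
Import Order.TTheory GRing.Theory Num.Theory.
Import numFieldNormedType.Exports.
Local Open Scope classical_set_scope.
Local Open Scope ring_scope.

(** The whole theorem is the classical picture of convexity with the values of
    [f] at the far points lifted by [Phi] of their distance to the point [u]
    under consideration.  Write [g_u x = f x + Phi `|u - x|].  Each of the four
    conditions compares [f u] with [g_u] only:

    - Phi-convexity says that [f u] lies below every chord of [g_u] joining a
      point [x <= u] to a point [y >= u];
    - the slope condition says the same for [x < u < y], with the chord split
      at [u] and denominators cleared (lemma [Phi_convex_slopes]);
    - the affine minorant in the third condition is a line through [(u, f u)]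
      below [g_u], that is, a support line;
    - the last condition is Jensen's inequality for [g_u] at the mean [u].

    Slopes yield a support line by completeness of the reals: the slopes from
    points to the left of [u] are bounded above by any slope to the right, and
    their supremum separates the two families (lemma [slopes_support]).
    Openness of the interval provides points on both sides of [u], so that
    this supremum exists.  A support line yields Jensen's inequality by
    averaging, as the linear term has mean zero (lemma [support_jensen]), and
    two-point averages give back Phi-convexity (lemma [jensen_Phi_convex]).

    At [x = u] the support inequality reads [0 <= Phi 0]; this is where the
    nonnegativity of [Phi] enters (lemma [error_function_ge0_at0]). *)

(** * Intervals and means *)

Lemma open_two_sided (R : realType) (I : set R) (u : R) :
  open I -> I u -> exists x y : R, [/\ I x, I y, x < u & u < y].
Proof.
move=> I_open Iu.
have /nbhs_ballP[e /= e_gt0 ballI] : nbhs u I by exact: open_nbhs_nbhs.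
have e2_gt0 : 0 < e / 2 by rewrite divr_gt0.
exists (u - e / 2), (u + e / 2); split; last 2 first.
- by rewrite ltrBlDr ltrDl.
- by rewrite ltrDl.
- by apply: ballI; rewrite /ball /= opprB addrC subrK gtr0_norm//; lra.
- by apply: ballI; rewrite /ball /= opprD addNKr normrN gtr0_norm//; lra.
Qed.

(** A nonempty open interval has positive length, so [0] lies in the domain on
    which an error function is required to be nonnegative. *)
Lemma error_function_ge0_at0 (R : realType) (I : set R) (Phi : R -> R) :
  I !=set0 -> open I -> is_interval I -> error_function I Phi -> 0 <= Phi 0.
Proof.
move=> [u Iu] I_open I_itv; apply; split => //.
have [x [y [Ix Iy xu uy]]] := open_two_sided I_open Iu.
have xy : x < y by exact: lt_trans uy.
apply: (@lt_le_trans _ _ (wlength (@idfun R) `[x, y])).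
  by rewrite wlength_itv_bnd ?ltW//= lte_fin subr_gt0.
apply: le_wlength => // z /=; rewrite in_itv /=; exact: I_itv.
Qed.

Lemma exists_le_mean (R : realDomainType) (n : nat) (x t : 'I_n -> R) :
  (forall i, 0 <= t i) -> \sum_(i < n) t i = 1 ->
  exists i, x i <= \sum_(j < n) t j * x j.
Proof.
move=> t_ge0 t1; apply/existsP; apply: contraT; rewrite negb_exists => /forallP.
set u := \sum_(j < n) _ => x_gt.
have {}x_gt i : 0 < x i - u by rewrite subr_gt0 ltNge x_gt.
(* The nonnegative terms t i * (x i - u) sum to zero, which kills every t i. *)
have sum0 : \sum_(i < n) t i * (x i - u) = 0.
  under eq_bigr do rewrite mulrBr.
  by rewrite sumrB -mulr_suml t1 mul1r subrr.
have t0 i : t i = 0.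
  have term_ge0 k : true -> 0 <= t k * (x k - u) by rewrite mulr_ge0// ltW.
  have /eqP := psumr_eq0P term_ge0 sum0 (i := i) isT.
  by rewrite mulf_eq0 (gt_eqF (x_gt i)) orbF => /eqP.
by move: t1; rewrite big1// => /eqP; rewrite eq_sym oner_eq0.
Qed.

Lemma is_interval_mean (R : realType) (I : set R) (n : nat) (x t : 'I_n -> R) :
  is_interval I -> (forall i, I (x i)) -> (forall i, 0 <= t i) ->
  \sum_(i < n) t i = 1 -> I (\sum_(i < n) t i * x i).
Proof.
move=> I_itv Ix t_ge0 t1.
have [i xi_le] := exists_le_mean x t_ge0 t1.
have [j] := exists_le_mean (fun k => - x k) t_ge0 t1.
under eq_bigr do rewrite mulrN.
rewrite sumrN lerN2 => le_xj.
by apply: (I_itv _ _ (Ix i) (Ix j)); rewrite xi_le.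
Qed.

(** * The cycle of implications *)

(** With [t = (y - u) / (y - x)] the mean of [x] and [y] is [u], and the
    Phi-convexity inequality at [t] times [y - x] is the slope inequality with
    its denominators cleared. *)
Lemma Phi_convex_slopes (R : realType) (I : set R) (Phi f : R -> R) :
  Phi_convex I Phi f ->
  forall x u y : R, I x -> I u -> I y -> x < u -> u < y ->
    (f u - f x - Phi (u - x)) / (u - x) <= (f y - f u + Phi (y - u)) / (y - u).
Proof.
move=> cvx x u y Ix _ Iy xu uy.
have ux_gt0 : 0 < u - x by rewrite subr_gt0.
have yu_gt0 : 0 < y - u by rewrite subr_gt0.
have yx_gt0 : 0 < y - x by lra.
have yx_neq0 : y - x != 0 by rewrite gt_eqF.
pose t := (y - u) / (y - x).
have tE : t * (y - x) = y - u by rewrite /t divfK.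
have t01 : 0 <= t <= 1.
  by rewrite /t ler_pdivrMr// mul1r divr_ge0//=; lra.
have := cvx x y t Ix Iy t01.
rewrite distrC gtr0_norm// tE.
rewrite (_ : (1 - t) * (y - x) = u - x); last by rewrite mulrBl tE; ring.
rewrite (_ : t * x + (1 - t) * y = u); last first.
  by transitivity (y - t * (y - x)); [ring | rewrite tE subKr].
rewrite -(ler_pM2r yx_gt0).
rewrite (_ : (_ + (1 - t) * Phi _) * (y - x) =
    t * (y - x) * (f x + Phi (u - x)) +
    (y - x - t * (y - x)) * (f y + Phi (y - u))); last by ring.
by rewrite tE => fu; rewrite ler_pdivrMr// mulrAC ler_pdivlMr//; lra.
Qed.

(** [phi u] is the supremum of the corrected slopes from the left of [u].  Any
    [y > u] in the interval bounds these slopes from above, and the resulting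
    inequality is the support property at [y]; an [x < u] in the interval makes
    the family of slopes nonempty. *)
Lemma slopes_support (R : realType) (I : set R) (Phi f : R -> R) :
  open I -> 0 <= Phi 0 ->
  (forall x u y : R, I x -> I u -> I y -> x < u -> u < y ->
    (f u - f x - Phi (u - x)) / (u - x) <=
    (f y - f u + Phi (y - u)) / (y - u)) ->
  exists phi : R -> R, forall x u : R, I x -> I u ->
    f u + (x - u) * phi u <= f x + Phi `|u - x|.
Proof.
move=> I_open Phi0 slopes.
pose S u :=
  [set (f u - f x - Phi (u - x)) / (u - x) | x in I `&` [set x | x < u]].
have S_ub u y : I u -> I y -> u < y ->
    ubound (S u) ((f y - f u + Phi (y - u)) / (y - u)).
  by move=> Iu Iy uy _ [x [Ix xu] <-]; exact: slopes.
exists (fun u => sup (S u)) => x u Ix Iu.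
have [x0 [y0 [Ix0 Iy0 x0u uy0]]] := open_two_sided I_open Iu.
have [xu|ux|->] := ltgtP x u.
- have : (f u - f x - Phi (u - x)) / (u - x) <= sup (S u).
    apply: ub_le_sup; last by exists x.
    by eexists; exact: S_ub Iu Iy0 uy0.
  by rewrite gtr0_norm ?subr_gt0// ler_pdivrMr ?subr_gt0//; lra.
- have : sup (S u) <= (f x - f u + Phi (x - u)) / (x - u).
    apply: ge_sup; last exact: S_ub.
    by eexists; exists x0.
  by rewrite distrC gtr0_norm ?subr_gt0// ler_pdivlMr ?subr_gt0//; lra.
- by rewrite !subrr mul0r normr0 addr0 lerDl.
Qed.

(** Averaging the support inequality at the mean [u] over the points [x i]
    cancels the linear term, since the [x i - u] have mean zero. *)
Lemma support_jensen (R : realType) (I : set R) (Phi f phi : R -> R) :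
  is_interval I ->
  (forall x u : R, I x -> I u ->
    f u + (x - u) * phi u <= f x + Phi `|u - x|) ->
  forall (n : nat) (x t : 'I_n -> R),
    (forall i, I (x i)) -> (forall i, 0 <= t i) -> \sum_(i < n) t i = 1 ->
    f (\sum_(i < n) t i * x i) <=
    \sum_(i < n) t i * (f (x i) + Phi `|\sum_(j < n) t j * x j - x i|).
Proof.
move=> I_itv support n x t Ix t_ge0 t1.
have := is_interval_mean I_itv Ix t_ge0 t1.
set u := \sum_(i < n) t i * x i => Iu.
have fuE : f u = \sum_(i < n) t i * (f u + (x i - u) * phi u).
  under eq_bigr do rewrite mulrDr mulrA mulrBr.
  by rewrite big_split /= -!mulr_suml sumrB -mulr_suml t1 !mul1r subrr mul0r addr0.
by rewrite {1}fuE; apply: ler_sum => i _; rewrite ler_wpM2l ?support.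
Qed.

(** The mean [u] of [x] and [y] with weights [t] and [1 - t] is at distance
    [(1 - t) * `|x - y|] from [x] and [t * `|x - y|] from [y]. *)
Lemma jensen_Phi_convex (R : realType) (I : set R) (Phi f : R -> R) :
  (forall (n : nat) (x t : 'I_n -> R),
    (forall i, I (x i)) -> (forall i, 0 <= t i) -> \sum_(i < n) t i = 1 ->
    f (\sum_(i < n) t i * x i) <=
    \sum_(i < n) t i * (f (x i) + Phi `|\sum_(j < n) t j * x j - x i|)) ->
  Phi_convex I Phi f.
Proof.
move=> jensen x y t Ix Iy /andP[t_ge0 t_le1].
have s_ge0 : 0 <= 1 - t by rewrite subr_ge0.
pose p (i : 'I_2) := if i == ord0 then x else y.
pose w (i : 'I_2) := if i == ord0 then t else 1 - t.
have Ip i : I (p i) by rewrite /p; case: ifP.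
have w_ge0 i : 0 <= w i by rewrite /w; case: ifP.
have w1 : \sum_(i < 2) w i = 1.
  by rewrite !big_ord_recl big_ord0 /w /= addr0 addrC subrK.
have := jensen 2 p w Ip w_ge0 w1.
rewrite !big_ord_recl !big_ord0 /p /w /= !addr0.
rewrite (_ : t * x + (1 - t) * y - x = (1 - t) * (y - x)); last by ring.
rewrite (_ : t * x + (1 - t) * y - y = t * (x - y)); last by ring.
by rewrite !normrM (ger0_norm t_ge0) (ger0_norm s_ge0) (distrC y x); lra.
Qed.

Theorem theorem3p1 (R : realType) (I : set R)
    (I_nonempty : I !=set0) (I_open : open I) (I_itv : is_interval I)
    (Phi f : R -> R) (Phi_error : error_function I Phi) :
  [<-> Phi_convex I Phi f;
       forall x u y : R, I x -> I u -> I y -> x < u -> u < y ->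
         (f u - f x - Phi (u - x)) / (u - x) <=
         (f y - f u + Phi (y - u)) / (y - u);
       exists phi : R -> R, forall x u : R, I x -> I u ->
         f u + (x - u) * phi u <= f x + Phi `|u - x|;
       forall (n : nat) (x t : 'I_n -> R),
         (forall i, I (x i)) -> (forall i, 0 <= t i) -> \sum_(i < n) t i = 1 ->
         f (\sum_(i < n) t i * x i) <=
         \sum_(i < n) t i * (f (x i) + Phi `|\sum_(j < n) t j * x j - x i|)].
Proof.
have Phi0 : 0 <= Phi 0.
  exact: error_function_ge0_at0 I_nonempty I_open I_itv Phi_error.
tfae.
- exact: Phi_convex_slopes.
- exact: slopes_support.
- by move=> [phi support]; exact: support_jensen I_itv support.
- exact: jensen_Phi_convex.
Qed.
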